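(* Let $X$ be a topological space and $\lambda$ an infinite cardinal. For every cardinal $\delta$, let $X^\delta$ be endowed with the Tychonoff topology, and let $\mathcal F^\delta$ be either (for all $\delta$) the family of all subsets of $X^\delta$ which are products of $\delta$ nonempty open sets of $X$, or (for all $\delta$) the family of all nonempty open sets of $X^\delta$ in the box topology. Then the following are equivalent. (1) There exists some ultrafilter $D$ uniform over $\lambda$ such that $X$ is $D$-pseudocompact. (2) There exists some ultrafilter $D$ uniform over $\lambda$ such that, for every cardinal $\delta$, every $\lambda$-indexed sequence of members of $\mathcal F^\delta$ has some $D$-limit point in $X^\delta$ (with the Tychonoff topology). (3) For every cardinal $\delta$, in $X^\delta$ (with the Tychonoff topology) every $\lambda$-indexed sequence of members of $\mathcal F^\delta$ has a $\lambda$-complete accumulation point. (4) For $\delta=\min\{2^{2^\lambda},\kappa^\lambda\}$, where $\kappa$ is the weight of $X$, in $X^\delta$ (with the Tychonoff topology) every $\lambda$-indexed sequence of members of $\mathcal F^\delta$ has a $\lambda$-complete accumulation point. If $\lambda$ is regular, each of the following two conditions is also equivalent to the preceding ones. (5) For every cardinal $\delta$, $X^\delta$ (with the Tychonoff topology) is $\mathcal F^\delta$-$[\lambda,\lambda]$-compact. (6) For every cardinal $\delta$ and every family $(C_\alpha)_{\alpha\in\lambda}$ of closed sets of $X^\delta$ (with the Tychonoff topology) such that $C_\alpha\supseteq C_\beta$ whenever $\alpha\le\beta<\lambda$: if for every $\alpha\in\lambda$ there exists $F\in\mathcal F^\delta$ such that $C_\alpha\supseteq F$, then $\bigcap_{\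alpha\in\lambda}C_\alpha\neq\emptyset$.
   Context: No separation axioms are assumed. An ultrafilter $D$ over an infinite cardinal $\lambda$ is uniform if every member of $D$ has cardinality $\lambda$. Let $(Y_\alpha)_{\alpha\in\lambda}$ be a sequence of subsets of a space $Y$ (repetitions allowed). A point $y\in Y$ is a $\lambda$-complete accumulation point of it if $|\{\alpha\in\lambda\mid Y_\alpha\cap U\neq\emptyset\}|=\lambda$ for every neighborhood $U$ of $y$ in $Y$. If $D$ is an ultrafilter over $\lambda$, $y$ is a $D$-limit point of it if $\{\alpha\in\lambda\mid Y_\alpha\cap U\ne\emptyset\}\in D$ for every neighborhood $U$ of $y$ in $Y$. $X$ is $D$-pseudocompact ($D$ an ultrafilter over $\lambda$) if every sequence $(O_\alpha)_{\alpha\in\lambda}$ of nonempty open subsets of $X$ has some $D$-limit point in $X$. For a family $\mathcal G$ of subsets of a space $Y$, $Y$ is $\mathcal G$-$[\lambda,\lambda]$-compact if: for every family $(C_\alpha)_{\alpha\in\lambda}$ of closed sets of $Y$, if for every $Z\subseteq\lambda$ with $|Z|<\lambda$ there exists $G\in\mathcal G$ such that $\bigcap_{\alpha\in Z}C_\alpha\supseteq G$, then $\bigcap_{\alpha\in\lambda}C_\alpha\neq\emptyset$ (the intersection over $Z=\emptyset$ is $Y$). The weight of $X$ is the least cardinality of a base of $X$ (bases are taken to consist of nonempty sets). *)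

(* Defs.v *)
From HB Require Import structures.
From mathcomp Require Import all_boot all_order.
From mathcomp Require Import boolp classical_sets functions cardinality filter.
From mathcomp Require Import topology_structure function_spaces.

Set Implicit Arguments.
Unset Strict Implicit.
Unset Printing Implicit Defensive.

Local Open Scope classical_set_scope.
Local Open Scope card_scope.

(* A cardinal is represented by any type of that cardinality. Where its order
   matters it is an initial ordinal: a well-ordered type all of whose proper
   initial segments have strictly smaller cardinality. *)

Definition card_lt T U (A : set T) (B : set U) : Prop :=
  A #<= B /\ A #!= B.

Definition initial_ordinal {d : Order.disp_t} (L : orderType d) : Prop :=
  (forall A : set L, A !=set0 -> exists2 m, A m & forall a, A a -> (m <= a)%O) /\
  (forall a : L, card_lt [set b : L | (b < a)%O] [set: L]).

Definition regular_cardinal {d : Order.disp_t} (L : orderType d) : Prop :=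
  forall A : set L, (forall a, exists2 b, A b & (a <= b)%O) -> A #= [set: L].

Definition min_card (A B : Type) : Type :=
  if [set: A] #<= [set: B] then A else B.

Definition uniform_ultrafilter L (D : set_system L) : Prop :=
  UltraFilter D /\ forall A, D A -> A #= [set: L].

Definition complete_accumulation_point L (Y : topologicalType)
    (Ys : L -> set Y) (y : Y) : Prop :=
  forall U, nbhs y U -> [set a | Ys a `&` U !=set0] #= [set: L].

Definition D_limit_point L (D : set_system L) (Y : topologicalType)
    (Ys : L -> set Y) (y : Y) : Prop :=
  forall U, nbhs y U -> D [set a | Ys a `&` U !=set0].

Definition D_pseudocompact L (D : set_system L) (X : topologicalType) : Prop :=
  forall O : L -> set X, (forall a, open (O a) /\ O a !=set0) ->
  exists x, D_limit_point D O x.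

(* G-[lambda, lambda]-compactness of Y, where lambda is the cardinality of L *)
Definition family_compact (L : Type) (Y : topologicalType) (G : set (set Y)) :
    Prop :=
  forall C : L -> set Y, (forall a, closed (C a)) ->
  (forall Z : set L, card_lt Z [set: L] ->
     exists2 S, G S & S `<=` \bigcap_(a in Z) C a) ->
  \bigcap_a C a !=set0.

(* Both families below are sets of subsets of the carrier of X^I; only
   [box_opens] refers to the box topology, whose basic opens are the products
   of open sets. *)
Definition open_boxes (X : topologicalType) (I : Type) :
    set (set {ptws I -> X}) :=
  [set W | exists2 O : I -> set X, (forall i, open (O i) /\ O i !=set0) &
           W = [set f | forall i, O i (f i)]].

Definition box_opens (X : topologicalType) (I : Type) :
    set (set {ptws I -> X}) :=
  [set W | W !=set0 /\
     forall f, W f -> exists O : I -> set X,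
       [/\ forall i, open (O i), forall i, O i (f i) &
           [set g | forall i, O i (g i)] `<=` W]].

Definition nonempty_basis (X : topologicalType) (B : set (set X)) : Prop :=
  basis B /\ forall U, B U -> U !=set0.

Definition minimal_basis (X : topologicalType) (B : set (set X)) : Prop :=
  nonempty_basis B /\ forall B' : set (set X), nonempty_basis B' -> B #<= B'.

Lemma exists_min_card T (P : set (set T)) :
  P !=set0 -> exists2 A, P A & forall B, P B -> A #<= B.
Proof.
move=> [A0 PA0].
pose ok (S : set (set T -> T)) :=
  (forall f B, S f -> P B -> B (f B)) /\
  (forall B f g, P B -> S f -> S g -> f B = g B -> f = g).
have [F Fok Ftot|S [[Sin Sinj] Smax]] := @Zorn_bigcup _ ok.
  split=> [f B [S FS Sf] PB|B f g PB [S FS Sf] [S' FS' Sg]].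
    exact: ((Fok _ FS).1 f B Sf PB).
  have [sub|sub] := Ftot _ _ FS FS'.
    exact: ((Fok _ FS').2 B f g PB (sub _ Sf) Sg).
  exact: ((Fok _ FS).2 B f g PB Sf (sub _ Sg)).
have [[A PA Asurj]|noA] :=
    pselect (exists2 A, P A & forall t, A t -> exists2 f, S f & f A = t).
  exists A => // B PB.
  have /choice[k kP] : forall t : A, exists f, S f /\ f A = val t.
    by move=> [t At]; have [f Sf ft] := Asurj _ (set_mem At); exists f.
  have kB t : k t B \in B by apply: mem_set; exact: (Sin _ _ (kP t).1 PB).
  apply/card_leP/injfunPex.
  exists (fun t : A => SigSub (kB t) : B) => // s t _ _ [] kst.
  apply: val_inj; rewrite -(kP s).2 -(kP t).2.
  by rewrite (Sinj B _ _ PB (kP s).1 (kP t).1 kst).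
have /choice[h hP] : forall B, exists t, P B -> B t /\ forall f, S f -> f B <> t.
  move=> B; have [PB|nPB] := pselect (P B); last first.
    have [t|nt] := pselect (exists t : T, True); last first.
      exfalso; apply: noA; exists A0 => // t; by case: nt; exists t.
    by case: t => t _; exists t.
  apply: contrapT => nt; apply: noA; exists B => // t Bt.
  apply: contrapT => nf; apply: nt; exists t => _; split=> // f Sf ft.
  by apply: nf; exists f.
exfalso; apply: (Smax (S `|` [set h])).
  split; first by move=> f Sf; left.
  by move=> /(_ h (or_intror erefl)) /((hP _ PA0).2 h); apply.
split=> [f B [Sf|->] PB|B f g PB [Sf|->] [Sg|->] //]; first exact: (Sin _ _ Sf PB).
- exact: (hP _ PB).1.
- exact: (Sinj B f g PB Sf Sg).
- by move=> /((hP _ PB).2 _ Sf).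
- by move=> /esym /((hP _ PB).2 _ Sg).
Qed.

Lemma exists_minimal_basis (X : topologicalType) :
  exists B : set (set X), minimal_basis B.
Proof.
have [|B Bb Bmin] := @exists_min_card _ (@nonempty_basis X); last by exists B.
exists [set U | open U /\ U !=set0]; split=> [|U []//].
split=> [U []//|x A /=]; rewrite nbhsE => -[U [oU Ux] UA].
by exists U => //; split=> //; split=> //; exists x.
Qed.

(* The weight of X is the cardinality of the type [weight X]. *)
Definition weight_basis (X : topologicalType) : set (set X) :=
  proj1_sig (cid (exists_minimal_basis X)).
Arguments weight_basis X : clear implicits.

Definition weight (X : topologicalType) : Type := weight_basis X.

Lemma weight_basisP (X : topologicalType) : minimal_basis (weight_basis X).
Proof. exact: proj2_sig (cid (exists_minimal_basis X)). Qed.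

(* Main.v *)
(* D-limit points are computed coordinatewise in a Tychonoff product, which gives
   (1) => (2) => (3) => (4). For (4) => (1), the sets of indices that meet the
   neighborhoods of a complete accumulation point generate a filter all of whose
   members have full cardinality; since a union of two small sets is small, it
   extends to a uniform ultrafilter D, and the given point is then a D-limit
   point. Apply this to a single sequence of boxes that codes all sequences of
   open sets that matter: when delta = 2^(2^lambda), the coordinates are the
   families D themselves, and coordinate D carries a counterexample to
   D-pseudocompactness when there is one; when delta = kappa^lambda, the
   coordinates are all lambda-sequences of basic open sets. As either choice of
   delta works, the two cardinals are never compared. For (5) and (6),
   accumulation is turned into decreasing closed sets by taking the closures of
   the tails; regularity makes cofinal sets large. *)
Require Import Defs.
From HB Require Import structures.
From mathcomp Require Import all_boot all_order.
From mathcomp Require Import boolp classical_sets functions cardinality filter.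
From mathcomp Require Import topology_structure function_spaces.
From mathcomp Require Import supremum_topology initial_topology.

Set Implicit Arguments.
Unset Strict Implicit.
Unset Printing Implicit Defensive.

Local Open Scope classical_set_scope.
Local Open Scope card_scope.

(** * Cardinal arithmetic of infinite sets *)

Lemma card_le_inj T U (A : set T) (B : set U) (f : T -> U) :
  set_fun A B f -> set_inj A f -> A #<= B.
Proof.
move=> fAB fI; have [] : $|{injfun A >-> B}| by apply/injfunPex; exists f.
exact: inj_card_le.
Qed.

(** Comparability follows from the existence of a member of least cardinality in the pair of [A] and
    [B]. *)
Lemma card_le_total T (A B : set T) : A #<= B \/ B #<= A.
Proof.
have [|C] := @exists_min_card _ [set A; B]; first by exists A; left.
case=> -> h; first by left; apply: h; right.
by right; apply: h; left.
Qed.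

(* By Zorn, [B] is partitioned into countably infinite blocks, up to a finite
   remainder [R] that is absorbed into one block [S0]. *)
Lemma infinite_set_setXbool T (B : set T) :
  infinite_set B -> B `*` [set: bool] #<= B.
Proof.
elim/Ppointed: T B => T B Binf.
  by have [x] := infinite_setN0 Binf; rewrite emptyE.
pose D := [set S : set T | [/\ S `<=` B, countable S & infinite_set S]].
have [E [ED Etriv Emax]] := ex_maximal_disjoint_subcollection id D.
pose R := B `\` \bigcup_(S in E) S.
(* An infinite remainder would contain a further countably infinite block, disjoint from those of
   [E], against maximality. *)
have Rfin : finite_set R.
  apply: contrapT => /infiniteP/card_subP[C Cnat CR].
  have [Ccount /infiniteP Cinf] := (card_eqPle _ _).1 Cnat.
  have CDE : ~ E C.
    move=> EC; have [x Cx] := infinite_setN0 Cinf.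
    by have [_] := CR x Cx; apply; exists C.
  apply: (Emax (C |` E)).
  - by split; [move=> S ES; right | move=> /(_ C (or_introl erefl))].
  - move=> S [->|/ED//]; split=> // x /CR[]//.
  - move=> S S' [->|ES] [->|ES'] // [x []] /=.
    + by move=> /CR[_ nE] S'x; exfalso; apply: nE; exists S'.
    + by move=> Sx /CR[_ nE]; exfalso; apply: nE; exists S.
    + by move=> Sx S'x; apply: Etriv => //; exists x.
have [S0 ES0] : E !=set0.
  apply/set0P/eqP => E0; apply: Binf; move: Rfin.
  by rewrite /R E0 bigcup_set0 setD0.
(* With [S0] enlarged by [R], the blocks still are countably infinite and disjoint, and now they
   cover [B]. *)
pose E' := (S0 `|` R) |` (E `\ S0).
have E'D : E' `<=` D.
  move=> S [->|[/ED//]]; have [S0B S0c S0i] := ED _ ES0; split.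
  - by move=> x [/S0B|[]].
  - rewrite -bigcup2E; apply: bigcup_countable => // -[|[|n]] _ //=.
    exact: finite_set_countable.
  - by apply: sub_infinite_set S0i => x; left.
have E'triv : trivIset E' id.
  have aux S : E S -> S <> S0 -> ~ ((S0 `|` R) `&` S !=set0).
    move=> ES SS0 [x [[S0x|[_ nEx]] Sx]]; last by apply: nEx; exists S.
    by apply: SS0; apply: Etriv => //; exists x.
  move=> S S' [->|[ES nS]] [->|[ES' nS']] //.
  - by move=> h; case: (aux S' ES' nS').
  - by rewrite setIC => h; case: (aux S ES nS).
  - by apply: Etriv.
have E'cover x : exists S, B x -> E' S /\ S x.
  have [Bx|nBx] := pselect (B x); last by exists set0.
  have [[S ES Sx]|nEx] := pselect ((\bigcup_(S in E) S) x); last first.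
    by exists (S0 `|` R) => _; split; [left|right].
  have [SS0|SS0] := pselect (S = S0); last by exists S => _; split => //; right.
  by exists (S0 `|` R) => _; split; [left|left; rewrite -SS0].
have [k kP] := choice E'cover.
have eP S : exists e : T * bool -> T,
    E' S -> set_fun (S `*` setT) S e /\ set_inj (S `*` setT) e.
  have [ES|nES] := pselect (E' S); last by exists fst.
  have [_ Sc Si] := E'D _ ES.
  have : S `*` [set: bool] #<= S.
    apply: (card_le_trans (B := [set: nat])); last exact/infiniteP.
    by apply: countableX.
  move=> /pcard_leP/injfunPex[e eS eI].
  by exists e.
have [e {}eP] := choice eP.
(* The blockwise injections glue: each maps into its own block, and distinct blocks are disjoint. *)
apply: (@card_le_inj _ _ _ _ (fun p => e (k p.1) p)).
  move=> [x b] [/= /kP[kx kxx] _]; have [+ _] := eP _ kx.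
  by move=> /(_ (x, b))/(_ (conj kxx I)) h; have [+ _ _] := E'D _ kx; apply.
move=> [x b] [y c] /set_mem[/= Bx _] /set_mem[/= By _] /= exy.
have [kx kxx] := kP _ Bx; have [ky kyy] := kP _ By.
have [ex eIx] := eP _ kx; have [ey _] := eP _ ky.
have kxy : k x = k y.
  apply: E'triv => //; exists (e (k x) (x, b)); split; first exact: ex.
  by rewrite exy; apply: ey.
apply: eIx; [exact/mem_set| |by rewrite exy kxy].
by apply/mem_set; split=> //=; rewrite kxy.
Qed.

(** The larger of the two sets is infinite, and the union injects into two copies of it, which are
    no larger than one. *)
Lemma card_setU_infinite T (A B : set T) :
  infinite_set [set: T] -> A `|` B #= [set: T] -> A #= [set: T] \/ B #= [set: T].
Proof.
elim/Ppointed: T A B => T A B Tinf.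
  by have [x] := infinite_setN0 Tinf; rewrite emptyE.
wlog AB : A B / A #<= B.
  move=> hw; have [|BA] := card_le_total A B; first exact: hw.
  by rewrite setUC => /(hw _ _ BA)[]; [right|left].
move=> ABT; right.
have Binf : infinite_set B.
  move=> Bfin; apply: Tinf; rewrite -(eq_finite_set ABT) finite_setU; split=> //.
  exact: card_le_finite AB Bfin.
rewrite card_eqPle; split; first exact: card_leT.
move: ABT; rewrite card_eqPle => -[_ TAB].
apply: (card_le_trans TAB); apply: card_le_trans (infinite_set_setXbool Binf).
move: AB => /pcard_leP/injfunPex[f fA fI].
(* Points of [A] go to one copy of [B] through [f]; the others lie in [B] and go to the other
   copy. *)
apply: (@card_le_inj _ _ _ _
  (fun x => if pselect (A x) then (f x, true) else (x, false))).
  by move=> x ABx /=; case: pselect => [Ax|nAx]; split=> //=; [exact: fA|case: ABx].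
move=> x y _ _ /=; case: pselect => Ax; case: pselect => Ay // -[] //.
by apply: fI; apply/mem_set.
Qed.

(** * Uniform ultrafilters *)

Lemma uniform_ultrafilter_filter L (D : set_system L) :
  uniform_ultrafilter D -> Filter D.
Proof. by move=> [DU _]; exact: filter_filter. Qed.

(* Any ultrafilter containing [G] and all complements of small sets is uniform. *)
Lemma filter_uniform_ultrafilter L (G : set_system L) :
  infinite_set [set: L] -> Filter G -> (forall A, G A -> A #= [set: L]) ->
  exists2 D, uniform_ultrafilter D & G `<=` D.
Proof.
move=> Linf Gf Gbig.
have small0 : @set0 L #!= [set: L].
  apply/negP => /card_esym; rewrite card_eq0 => /eqP L0.
  by apply: Linf; rewrite L0.
(* [H] is the filter generated by [G] and the complements of small sets. It is proper because a
   member of [G], being of full cardinality, is not contained in a small set. *)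
pose H : set_system L :=
  [set S | exists A B, [/\ G A, B #!= [set: L] & A `\` B `<=` S]].
have HP : ProperFilter H.
  split.
    move=> [A [B [GA Bs AB]]]; move/negP: Bs; apply.
    rewrite card_eqPle; split; first exact: card_leT.
    have /card_eqPle[_ /card_le_trans] := Gbig _ GA; apply.
    by apply: subset_card_le => x Ax; apply: contrapT => nBx; case: (AB x).
  split.
  - by exists setT, set0; split=> //; exact: filterT.
  - move=> S S' [A [B [GA Bs AB]]] [A' [B' [GA' Bs' AB']]].
    exists (A `&` A'), (B `|` B'); split; first exact: filterI.
      apply/negP => /(card_setU_infinite Linf)[h|h].
        by rewrite h in Bs.
      by rewrite h in Bs'.
    move=> x [[Ax A'x] nBB']; split.
      by apply: AB; split=> // Bx; apply: nBB'; left.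
    by apply: AB'; split=> // Bx; apply: nBB'; right.
  - move=> S S' SS' [A [B [GA Bs AB]]]; exists A, B; split=> //.
    exact: subset_trans AB SS'.
have [D [DU HD]] := ultraFilterLemma HP.
exists D; last first.
  by move=> A GA; apply: HD; exists A, set0; split=> // x [].
split=> // A DA; apply: contrapT => /negP As.
have /(filterI DA) : D (~` A).
  by apply: HD; exists setT, A; split; [exact: filterT|exact: As|move=> x []].
by rewrite setICr; exact: filter_not_empty.
Qed.

Lemma complete_accumulation_point_ultrafilter L (Y : topologicalType)
    (W : L -> set Y) (y : Y) :
  infinite_set [set: L] -> complete_accumulation_point W y ->
  exists2 D, uniform_ultrafilter D & D_limit_point D W y.
Proof.
move=> Linf yW.
pose G := filter_from (nbhs y) (fun U => [set a | W a `&` U !=set0]).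
have [|A [U yU UA]|D Du GD] := @filter_uniform_ultrafilter _ G Linf.
- apply: filter_from_filter; first by exists setT; exact: filterT.
  move=> U V yU yV; exists (U `&` V); first exact: filterI.
  by move=> a [x [Wx [Ux Vx]]]; split; exists x.
- have /card_eqPle[_ h] := yW _ yU.
  rewrite card_eqPle; split; first exact: card_leT.
  by apply: (card_le_trans h); exact: subset_card_le.
- by exists D => // U yU; apply: GD; exists U.
Qed.

(** * Neighborhoods and limit points in Tychonoff products *)

Lemma ptws_proj_nbhs (X : topologicalType) (I : Type) (y : {ptws I -> X}) (i : I)
    (U : set X) :
  nbhs (y i) U -> nbhs y [set f : {ptws I -> X} | U (f i)].
Proof.
have /cvg_sup/(_ i) h : nbhs y --> y by [].
move=> yU; apply: h.
exact: (@initial_continuous _ _ (fun f : {ptws I -> X} => f i) y U yU).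
Qed.

Lemma ptws_nbhs_box (X : topologicalType) (I : Type) (y : {ptws I -> X})
    (U : set {ptws I -> X}) :
  nbhs y U -> exists (J : set I) (V : I -> set X), [/\ finite_set J,
    forall i, nbhs (y i) (V i), forall i, ~ J i -> V i = setT &
    [set f : {ptws I -> X} | forall i, V i (f i)] `<=` U].
Proof.
pose H : set_system {ptws I -> X} :=
  [set U | exists (J : set I) (V : I -> set X), [/\ finite_set J,
    forall i, nbhs (y i) (V i), forall i, ~ J i -> V i = setT &
    [set f | forall i, V i (f i)] `<=` U]].
(* [H] is a filter converging to [y], hence contains every neighborhood of [y]. *)
have HF : Filter H.
  split.
  - exists set0, (fun=> setT); split=> // i; exact: filterT.
  - move=> A B [J [V [Jf yV JV VA]]] [J' [V' [Jf' yV' JV' VA']]].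
    exists (J `|` J'), (fun i => V i `&` V' i); split.
    + by rewrite finite_setU.
    + by move=> i; exact: filterI.
    + move=> i nJ; rewrite JV ?JV' ?setIT// => Ji; apply: nJ; [by right|by left].
    + by move=> f Vf; split; [apply: VA|apply: VA'] => i; have [] := Vf i.
  - move=> A B AB [J [V [Jf yV JV VA]]]; exists J, V; split=> //.
    exact: subset_trans VA AB.
suff : H --> y by apply.
(* The topology is the supremum of those induced by the coordinates, so convergence is checked one
   coordinate at a time, with boxes restricted only there. *)
apply/cvg_sup => i A; rewrite nbhsE => -[B [[C oC <-] /= Cy] BA].
exists [set i], (fun j => if pselect (j = i) then C else setT); split.
- exact: finite_set1.
- move=> j; case: pselect => [ji|_] /=; last exact: filterT.
  by rewrite ji; exact: open_nbhs_nbhs.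
- by move=> j /=; case: pselect.
- by move=> f Vf; apply: BA => /=; have := Vf i; case: pselect.
Qed.

Lemma open_boxes_box_opens (X : topologicalType) (I : Type) :
  @open_boxes X I `<=` @box_opens X I.
Proof.
move=> _ [O OP ->]; split; last by move=> f Of; exists O; split=> // i; have [] := OP i.
have [f fP] := choice (fun i => (OP i).2).
by exists f.
Qed.

Lemma box_opens_contain_box (X : topologicalType) (I : Type)
    (W : set {ptws I -> X}) :
  box_opens W -> exists2 S, open_boxes S & S `<=` W.
Proof.
move=> [[f Wf] /(_ f Wf) [O [oO Of OW]]].
by exists [set g | forall i, O i (g i)] => //; exists O => // i; split; last exists (f i).
Qed.

Lemma filter_bigcap_finite T (I : Type) (J : set I) (f : I -> set T)
    (F : set_system T) :
  Filter F -> finite_set J -> (forall i, J i -> F (f i)) ->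
  F (\bigcap_(i in J) f i).
Proof.
(* [{classic I}] gives the bare type [I] the choice structure needed to enumerate [J]. *)
move=> FF Jf FJ; have /finite_fsetP[E JE] : finite_set (J : set {classic I}) by [].
rewrite JE; apply: (@filter_bigI _ {classic I}) => i iE; apply: FJ.
by rewrite JE.
Qed.

(** A basic neighborhood restricts finitely many coordinates, and [D] is closed under finite
    intersections; at the other coordinates any point of the nonempty [O a i] serves. *)
Lemma D_limit_point_box (X : topologicalType) (I L : Type) (D : set_system L)
    (O : L -> I -> set X) (y : {ptws I -> X}) :
  Filter D ->
  (forall a i, O a i !=set0) ->
  (forall i, D_limit_point D (O^~ i) (y i)) ->
  D_limit_point D (fun a => [set f : {ptws I -> X} | forall i, O a i (f i)]) y.
Proof.
move=> DF O0 yD U /ptws_nbhs_box[J [V [Jf yV JV VU]]].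
have DJ : D (\bigcap_(i in J) [set a | O a i `&` V i !=set0]).
  apply: filter_bigcap_finite => // i _.
  exact: yD.
apply: filterS DJ => a aJ.
have /choice[f fP] : forall i, exists x, O a i x /\ V i x.
  move=> i; have [Ji|nJi] := pselect (J i); first exact: aJ.
  by have [x Ox] := O0 a i; exists x; rewrite JV.
by exists f; split=> [i|]; [exact: (fP i).1|apply: VU => i; exact: (fP i).2].
Qed.

Lemma D_limit_point_proj (X : topologicalType) (I L : Type) (D : set_system L)
    (O : L -> I -> set X) (y : {ptws I -> X}) (i : I) :
  Filter D ->
  D_limit_point D (fun a => [set f : {ptws I -> X} | forall i, O a i (f i)]) y ->
  D_limit_point D (O^~ i) (y i).
Proof.
move=> DF yD U yU.
apply: filterS (yD _ (ptws_proj_nbhs yU)) => a [f [/= Of Uf]].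
by exists (f i).
Qed.

(** Each [W a] is shrunk to a box, limits are chosen coordinate by coordinate, and a limit point of
    the smaller sets is one of the larger. *)
Lemma D_pseudocompact_box (X : topologicalType) (L : Type) (D : set_system L)
    (I : Type) (W : L -> set {ptws I -> X}) :
  Filter D -> D_pseudocompact D X ->
  (forall a, box_opens (W a)) -> exists y, D_limit_point D W y.
Proof.
move=> DF DX Wbox.
have /choice[O OP] : forall a, exists O : I -> set X,
    (forall i, open (O i) /\ O i !=set0) /\ [set f | forall i, O i (f i)] `<=` W a.
  by move=> a; have [_ [O OP ->] OW] := box_opens_contain_box (Wbox a); exists O.
have /choice[y yP] : forall i, exists x, D_limit_point D (O^~ i) x.
  by move=> i; apply: DX => a; exact: (OP a).1.
exists y => U yU.
have := @D_limit_point_box X I L D O y DF (fun a i => ((OP a).1 i).2) yP U yU.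
by apply: filterS => a [f [Of Uf]]; exists f; split=> //; exact: (OP a).2.
Qed.

Lemma D_limit_point_uniform L (D : set_system L) (Y : topologicalType)
    (W : L -> set Y) (y : Y) :
  uniform_ultrafilter D -> D_limit_point D W y -> complete_accumulation_point W y.
Proof. by move=> [_ DL] yD U /yD/DL. Qed.

(** * From complete accumulation points to pseudocompactness *)

(** Limit points survive enlarging the sets, so this reduces pseudocompactness to sequences of basic
    open sets. *)
Lemma basis_sequence_refine (X : topologicalType) (B : set (set X)) (L : Type)
    (O : L -> set X) :
  basis B -> (forall a, open (O a) /\ O a !=set0) ->
  exists s : L -> B, forall a, val (s a) `<=` O a.
Proof.
move=> [_ Bb] OP.
suff /choice[s sO] : forall a, exists U : B, val U `<=` O a by exists s.
move=> a; have [oO [x Ox]] := OP a.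
have [U [BU Ux] UO] := Bb x (O a) (open_nbhs_nbhs (conj oO Ox)).
by exists (SigSub (mem_set BU)).
Qed.

Lemma box_accumulation_D_pseudocompact (X : topologicalType) (L I : Type) :
  infinite_set [set: L] ->
  I = set (set L) \/ I = (L -> weight X) ->
  (forall W : L -> set {ptws I -> X}, (forall a, open_boxes (W a)) ->
     exists y, complete_accumulation_point W y) ->
  exists D : set_system L, uniform_ultrafilter D /\ D_pseudocompact D X.
Proof.
move=> Linf IE acc.
(* Without any sequence of nonempty open sets, every uniform ultrafilter works vacuously. Otherwise
   [O0] is the filler for coordinates that need no counterexample. *)
have [[O0 OP0]|noO] := pselect (exists O : L -> set X,
    forall a, open (O a) /\ O a !=set0); last first.
  have [A TA|D Du _] := filter_uniform_ultrafilter Linf (globally_filter setT).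
    by have -> : A = setT by apply/seteqP; split=> // a _; exact: TA.
  by exists D; split=> // O OP; case: noO; exists O.
suff [O OP OD] : exists2 O : L -> I -> set X,
    (forall a i, open (O a i) /\ O a i !=set0) &
    forall (y : I -> X) (D : set_system L), uniform_ultrafilter D ->
    (forall i, D_limit_point D (O^~ i) (y i)) -> D_pseudocompact D X.
  have [|y yW] := acc (fun a => [set f | forall i, O a i (f i)]).
    by move=> a; exists (O a).
  have [D Du yD] := complete_accumulation_point_ultrafilter Linf yW.
  have DF : Filter D by exact: uniform_ultrafilter_filter.
  exists D; split=> //; apply: (OD y) => // i.
  exact: D_limit_point_proj yD.
case: IE => IE; subst I.
  (* The ultrafilter is known only after the accumulation point, so every set system gets a
     coordinate in advance. *)
  have /choice[O OP] : forall D : set (set L), exists o : L -> set X,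
      (forall a, open (o a) /\ o a !=set0) /\
      ((exists x, D_limit_point D o x) -> D_pseudocompact D X).
    move=> D; have [DX|nDX] := pselect (D_pseudocompact D X); first by exists O0.
    apply: contrapT => no; apply: nDX => o oP; apply: contrapT => nx.
    by apply: no; exists o; split.
  exists (fun a D => O D a) => [a D|y D _ yD]; first exact: (OP D).1.
  by apply: (OP D).2; exists (y D); exact: yD.
have [[Bo Bb] B0] := (weight_basisP X).1.
exists (fun a (s : L -> weight X) => val (s a)) => [a s|y D Du yD O OP].
  have Bs := set_mem (valP (s a)).
  by split; [exact: Bo | exact: B0].
have [s sO] := basis_sequence_refine (conj Bo Bb) OP.
have DF : Filter D by exact: uniform_ultrafilter_filter.
exists (y s) => U /yD; apply: filterS => a [x [sx Ux]].
by exists x; split=> //; exact: sO.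
Qed.

(** * Initial ordinals, decreasing closed sets and regularity *)

Section initial_ordinals.
Variables (d : Order.disp_t) (L : orderType d).
Hypotheses (Linit : initial_ordinal L) (Linf : infinite_set [set: L]).
Import Order.TTheory.
Local Open Scope order_scope.

(** Adding one point to a small initial segment keeps it small, as [L] is infinite. *)
Lemma initial_ordinal_le_card_lt (a : L) : card_lt [set b : L | b <= a] [set: L].
Proof.
split; first exact: card_leT.
have -> : [set b | b <= a] = [set b | b < a] `|` [set a].
  apply/seteqP; split=> b /=; rewrite le_eqVlt => //.
    by move=> /orP[/eqP|]; [right|left].
  by case=> [->|->]; rewrite ?eqxx ?orbT.
apply/negP => /(card_setU_infinite Linf)[h|h].
  by have [_ /negP] := Linit.2 a.
by apply: Linf; rewrite -(eq_finite_set h); exact: finite_set1.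
Qed.

(** A set with no element above [a] would lie in the initial segment below [a], which is too
    small. *)
Lemma full_card_cofinal (A : set L) (a : L) :
  A #= [set: L] -> exists2 b, A b & a <= b.
Proof.
move=> AL; apply: contrapT => noA.
have [_ /negP] := Linit.2 a; apply.
rewrite card_eqPle; split; first exact: card_leT.
have /card_eqPle[_ /card_le_trans] := AL; apply.
apply: subset_card_le => b Ab /=; rewrite ltNge; apply/negP => ab.
by apply: noA; exists b.
Qed.

(** Every neighborhood of an accumulation point of chosen sets [W a] inside [C a] meets some [W b]
    with [b] beyond any given [a], hence meets [C a], which is closed. *)
Lemma decreasing_closed_meet (Y : topologicalType) (G : set (set Y)) :
  (forall W : L -> set Y, (forall a, G (W a)) ->
     exists y, complete_accumulation_point W y) ->
  forall C : L -> set Y, (forall a, closed (C a)) ->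
  (forall a b, a <= b -> C b `<=` C a) ->
  (forall a, exists2 S, G S & S `<=` C a) -> \bigcap_a C a !=set0.
Proof.
move=> acc C Cc Cd CG.
have /choice[W WP] : forall a, exists S, G S /\ S `<=` C a.
  by move=> a; have [S] := CG a; exists S.
have [y yW] := acc W (fun a => (WP a).1).
exists y => a _; apply: Cc => U yU.
have [b [x [Wx Ux]] ab] := full_card_cofinal a (yW U yU).
by exists x; split=> //; apply: (Cd a b) => //; exact: (WP b).2.
Qed.

(** The intersections over the segments up to [a] decrease, and each involves fewer sets than the
    cardinality of [L]. *)
Lemma family_compact_of_decreasing (Y : topologicalType) (G : set (set Y)) :
  (forall C : L -> set Y, (forall a, closed (C a)) ->
    (forall a b, a <= b -> C b `<=` C a) ->
    (forall a, exists2 S, G S & S `<=` C a) -> \bigcap_a C a !=set0) ->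
  family_compact L G.
Proof.
move=> h C Cc CG.
have [|a b ab x Cx c /= ca|a|x Cx] := h (fun a => \bigcap_(b in [set b | b <= a]) C b).
- by move=> a; apply: closed_bigI => b _; exact: Cc.
- by apply: Cx => /=; exact: le_trans ab.
- by apply: CG; exact: initial_ordinal_le_card_lt.
- by exists x => a _; exact: (Cx a I a (lexx a)).
Qed.

Lemma regular_family_compact_accumulation (Y : topologicalType)
    (G : set (set Y)) :
  regular_cardinal L -> family_compact L G ->
  forall W : L -> set Y, (forall a, G (W a)) ->
  exists y, complete_accumulation_point W y.
Proof.
move=> Lreg cpt W WG.
have [||y yC] := cpt (fun a => closure (\bigcup_(b in [set b | a <= b]) W b)).
- by move=> a; exact: closed_closure.
- move=> Z [_ /negP ZL].
  (* By regularity an unbounded [Z] would have full cardinality. A bound [a] puts [W a] inside every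
     tail indexed by [Z]. *)
  have [a Za] : exists a, forall b, Z b -> b <= a.
    apply: contrapT => noa; apply: ZL; apply: Lreg => a.
    apply: contrapT => nob; apply: noa; exists a => b Zb.
    rewrite leNgt; apply/negP => /ltW ab.
    by apply: nob; exists b.
  exists (W a) => // x Wx b /Za ba; apply: subset_closure.
  by exists a.
- exists y => U yU; apply: Lreg => a.
  (* Meeting every tail makes the set of indices cofinal, hence of full cardinality by
     regularity. *)
  have [x [[b ab Wx] Ux]] := yC a I U yU.
  by exists b => //; exists x.
Qed.

End initial_ordinals.

(** * The equivalences *)

Theorem corollary5p5 (X : topologicalType) (d : Order.disp_t) (L : orderType d)
    (Linit : initial_ordinal L) (Linf : infinite_set [set: L])
    (F : forall I : Type, set (set {ptws I -> X}))
    (hF : F = @open_boxes X \/ F = @box_opens X) :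
  let c1 := exists D : set_system L,
    uniform_ultrafilter D /\ D_pseudocompact D X in
  let c2 := exists D : set_system L,
    uniform_ultrafilter D /\
    forall (I : Type) (W : L -> set {ptws I -> X}), (forall a, F I (W a)) ->
      exists y : {ptws I -> X}, D_limit_point D W y in
  let c3 := forall (I : Type) (W : L -> set {ptws I -> X}),
    (forall a, F I (W a)) ->
    exists y : {ptws I -> X}, complete_accumulation_point W y in
  let delta : Type := min_card (set (set L)) (L -> weight X) in
  let c4 := forall W : L -> set {ptws delta -> X},
    (forall a, F delta (W a)) ->
    exists y : {ptws delta -> X}, complete_accumulation_point W y in
  let c5 := forall I : Type, family_compact L (F I) in
  let c6 := forall (I : Type) (C : L -> set {ptws I -> X}),
    (forall a, closed (C a)) ->
    (forall a b, (a <= b)%O -> C b `<=` C a) ->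
    (forall a, exists2 S, F I S & S `<=` C a) ->
    \bigcap_a C a !=set0 in
  [<-> c1; c2; c3; c4] /\
  (regular_cardinal L -> (c1 <-> c5) /\ (c1 <-> c6)).
Proof.
move=> c1 c2 c3 delta c4 c5 c6.
(* Both choices of [F] lie between the open boxes and the box-open sets: limits are found for the
   larger family, and hypotheses are applied to the smaller. *)
have Fbox I : F I `<=` @box_opens X I.
  by case: hF => ->; [exact: open_boxes_box_opens|].
have boxF I : @open_boxes X I `<=` F I.
  by case: hF => ->; [|exact: open_boxes_box_opens].
have c12 : c1 -> c2.
  move=> [D [Du DX]]; exists D; split=> // I W WF.
  have DF : Filter D by exact: uniform_ultrafilter_filter.
  by apply: D_pseudocompact_box => // a; exact: Fbox.
have c23 : c2 -> c3.
  move=> [D [Du DW]] I W /DW[y yD]; exists y.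
  exact: D_limit_point_uniform yD.
have c34 : c3 -> c4 by move=> h; exact: h.
have c41 : c4 -> c1.
  move=> h; apply: (@box_accumulation_D_pseudocompact X L delta) => //.
    (* Whichever cardinal the minimum selects, it is one of the two index types that admit a
       coding. *)
    by rewrite /delta /min_card; case: ifP; [left|right].
  by move=> W WF; apply: h => a; exact: boxF.
split; first by tfae.
move=> Lreg.
have c36 : c3 -> c6 by move=> h I; exact: decreasing_closed_meet (h I).
have c65 : c6 -> c5 by move=> h I; exact: family_compact_of_decreasing (h I).
have c53 : c5 -> c3.
  by move=> h I; exact: regular_family_compact_accumulation (h I).
have c31 : c3 -> c1 by move=> /c34/c41.
split; split=> h.
- exact: c65 (c36 (c23 (c12 h))).
- exact: c31 (c53 h).
- exact: c36 (c23 (c12 h)).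
- exact: c31 (c53 (c65 h)).
Qed.
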